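(* Let $S$ be a Coe-semigroup. Then the set of sons of $S$ in the tree $G(\mathscr{C})$ is equal to: (1) $\{S\setminus\{x\}\mid x \text{ is an odd element of } \mathrm{msg}(S) \text{ with } x>F(S)\}$, if $\{F(S)+1,F(S)+2\}\nsubseteq\mathrm{msg}(S)$; (2) $\{S\setminus\{x\}\mid x \text{ is an odd element of } \mathrm{msg}(S) \text{ with } x>F(S)\}\cup\{S\setminus\{F(S)+1,F(S)+2\}\}$, if $\{F(S)+1,F(S)+2\}\subseteq\mathrm{msg}(S)$.
   Context: $\mathbb{N}=\{0,1,2,\ldots\}$. A numerical semigroup is a subset of $\mathbb{N}$ containing $0$, closed under addition and with finite complement in $\mathbb{N}$. A numerical semigroup $S$ is a Coe-semigroup if $\{x-1,x+1\}\subseteq S$ for every odd $x\in S$; $\mathscr{C}$ is the set of all Coe-semigroups. The Frobenius number is $F(S)=\max(\mathbb{Z}\setminus S)$ (so $F(\mathbb{N})=-1$), and $\mathrm{msg}(S)$ is the (unique, finite) minimal system of generators of $S$ as a submonoid of $(\mathbb{N},+)$. $G(\mathscr{C})$ is the directed graph with vertex set $\mathscr{C}$ whose edges are the pairs $(S,T)\in\mathscr{C}\times\mathscr{C}$ with $S\neq T$ and $T=S\cup\{F(S)-1,F(S)\}$; it is a tree with root $\mathbb{N}$. If $(T,S)$ is an edge, $T$ is called a son of $S$. *)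

(* Defs.v *)
From HB Require Import structures.
From mathcomp Require Import all_boot all_order all_algebra.
From mathcomp Require Import all_classical.

Set Implicit Arguments.
Unset Strict Implicit.
Unset Printing Implicit Defensive.

Import Order.TTheory GRing.Theory Num.Theory.

Local Open Scope ring_scope.
Local Open Scope classical_set_scope.

Definition submonoid (M : set nat) : Prop :=
  M 0%N /\ (forall x y, M x -> M y -> M (x + y)%N).

Definition numerical_semigroup (S : set nat) : Prop :=
  submonoid S /\ finite_set (~` S).

(* The truncated predecessor is harmless here, an odd x being positive. *)
Definition Coe_semigroup (S : set nat) : Prop :=
  numerical_semigroup S /\
  (forall x : nat, odd x -> S x -> [set x.-1; x.+1] `<=` S).

Definition Coe : set (set nat) := [set S | Coe_semigroup S].

(* F(S) lives in int because F(N) = -1, so subsets of nat are compared with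
   sets built from F(S) after embedding them into int. *)
Definition zset (A : set nat) : set int := [set n%:Z | n in A].

Definition max_of (A : set int) : set int := A `&` ubound A.

(* The default 0 is irrelevant: for a numerical semigroup S the set Z \ S
   contains -1 and is bounded above, so it has a (unique) maximum. *)
Definition Frobenius (S : set nat) : int := xget 0 (max_of (~` zset S)).

Definition generated (A : set nat) : set nat := smallest submonoid A.

Definition minimal_generators (S : set nat) : set (set nat) :=
  [set A | generated A = S /\ (forall B, B `<` A -> generated B <> S)].

(* Every submonoid of nat has exactly one minimal system of generators, so
   the default set0 is irrelevant. *)
Definition msg (S : set nat) : set nat := xget set0 (minimal_generators S).

(* The last equation is between subsets of int: for S = N the right-hand side
   contains -2 and -1, so N is the source of no edge. *)
Definition G_edge (S T : set nat) : Prop :=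
  [/\ Coe S, Coe T, S <> T &
      zset T = zset S `|` [set Frobenius S - 1; Frobenius S]].

Definition sons (S : set nat) : set (set nat) := [set T | G_edge T S].

(* Main.v *)
(** Past its Frobenius number a Coe-semigroup T contains all integers, so if
    F(T) is nonnegative and even then F(T) + 1 would be an odd element of T
    whose predecessor is not in T: F(T) is odd.  For T a son of S the only
    elements of S which may be missing from T are thus f = F(T), an odd number,
    and possibly f - 1; being removable, they are irreducible in S.  If f - 1 is
    removed too then the odd number f - 2 is not in T, whence F(S) = f - 2. *)
Require Import Defs.
From HB Require Import structures.
From mathcomp Require Import all_boot all_order all_algebra.
From mathcomp Require Import all_classical.
From mathcomp Require Import zify.

Set Implicit Arguments.
Unset Strict Implicit.
Unset Printing Implicit Defensive.

Import Order.TTheory GRing.Theory Num.Theory.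
Local Open Scope ring_scope.
Local Open Scope classical_set_scope.

(** * The Frobenius number as an integer maximum *)

Lemma zset_nat (A : set nat) (n : nat) : zset A n%:Z <-> A n.
Proof. by split=> [[m Am [<-]] //|An]; exists n. Qed.

Lemma cofinite_bound (S : set nat) :
  finite_set (~` S) -> exists N, forall n, (N <= n)%N -> S n.
Proof.
move=> /finite_seqP[s Ss]; exists (\max_(i <- s) i).+1 => n Nn.
apply: contrapT => nSn; have : (~` S) n by [].
rewrite Ss /= => ns.
by have := @leq_bigmax_seq nat s xpredT (fun i => i) n ns isT; rewrite leqNgt Nn.
Qed.

Lemma max_of_setC_zset (S : set nat) (f : int) :
  max_of (~` zset S) f <-> ~ zset S f /\ forall g, f < g -> zset S g.
Proof.
split=> -[nSf H]; split=> // g.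
  by move=> fg; apply: contrapT => /H; rewrite leNgt fg.
by move=> /= nSg; rewrite leNgt; apply/negP => /H.
Qed.

Lemma Frobenius_eq (S : set nat) (f : int) :
  ~ zset S f -> (forall g, f < g -> zset S g) -> Frobenius S = f.
Proof.
move=> nSf H; apply: xget_unique; first exact/max_of_setC_zset.
move=> g /max_of_setC_zset[nSg H'].
by case: (ltgtP f g) => // [/H|/H'].
Qed.

(** The maximum exists: a bound [N] from which on everything is in [S] is lowered until [N] itself
    is missing. If it reaches 0 then [S] is all of [nat], and the maximum is -1. *)
Lemma FrobeniusP (S : set nat) : finite_set (~` S) ->
  ~ zset S (Frobenius S) /\ forall g, Frobenius S < g -> zset S g.
Proof.
move=> /cofinite_bound[N SN].
suff [f [nSf H]] : exists f, ~ zset S f /\ forall g, f < g -> zset S g.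
  by rewrite (Frobenius_eq nSf H).
elim: N SN => [|N IH] SN.
  exists (-1); split=> [[n _] //|[g|g] fg]; last by lia.
  exact/zset_nat/SN.
have [SN'|nSN] := pselect (S N).
  by apply: IH => n; rewrite leq_eqVlt => /predU1P[<- //|]; exact: SN.
exists N%:Z; split; first by move/zset_nat.
by case=> g fg; [apply/zset_nat/SN; lia | lia].
Qed.

Lemma Frobenius_notin (S : set nat) (n : nat) :
  finite_set (~` S) -> Frobenius S = n%:Z -> ~ S n.
Proof. by move=> /FrobeniusP[nSF _] Fn Sn; apply: nSF; rewrite Fn; exact/zset_nat. Qed.

Lemma gt_Frobenius (S : set nat) (n : nat) :
  finite_set (~` S) -> Frobenius S < n%:Z -> S n.
Proof. by move=> /FrobeniusP[_ H] /H /zset_nat. Qed.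

Lemma Frobenius_geN1 (S : set nat) : finite_set (~` S) -> -1 <= Frobenius S.
Proof.
move=> /FrobeniusP[_ H]; rewrite leNgt; apply/negP => /H[n _]; lia.
Qed.

(** * Irreducible elements form the minimal system of generators *)

Definition irreducible (S : set nat) : set nat :=
  [set x | [/\ S x, x <> 0%N & forall a b, S a -> S b -> (a + b)%N = x ->
                                     a = 0%N \/ b = 0%N]].

Lemma submonoid_setD_irreducible (S D : set nat) :
  submonoid S -> D `<=` irreducible S -> submonoid (S `\` D).
Proof.
move=> [S0 SD] DI; split; first by split=> // /DI[].
move=> x y [Sx nDx] [Sy nDy]; split; first exact: SD.
move=> Dxy; have [_ _ /(_ x y Sx Sy erefl)[x0|y0]] := DI _ Dxy.
  by rewrite x0 in Dxy.
by rewrite y0 addn0 in Dxy.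
Qed.

(** Strong induction: a nonzero element of [S] that is not irreducible is a sum of two smaller
    elements of [S]. *)
Lemma generated_irreducible (S : set nat) :
  submonoid S -> generated (irreducible S) = S.
Proof.
move=> mS; apply/seteqP; split.
  by apply: smallest_sub => // x [].
move=> n Sn M [[M0 MD] IM].
elim/ltn_ind: n Sn => n IH Sn.
have [/IM //|nI] := pselect (irreducible S n).
have [->//|/eqP n0] := eqVneq n 0%N.
apply: contrapT => nMn; apply: nI; split=> // a b Sa Sb abn.
have [|/eqP a0] := eqVneq a 0%N; first by left.
have [|/eqP b0] := eqVneq b 0%N; first by right.
by case: nMn; rewrite -abn; apply: MD; apply: IH => //; lia.
Qed.

(** If an irreducible [x] were outside [A], then [S] without [x] would be a submonoid containing
    [A], so [A] could not generate [x]. *)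
Lemma irreducible_sub_generators (S A : set nat) :
  submonoid S -> generated A = S -> irreducible S `<=` A.
Proof.
move=> mS AS x Ix; apply: contrapT => nAx.
have : generated A x by rewrite AS; case: Ix.
suff /[apply] -[_] : generated A `<=` S `\ x by apply.
apply: smallest_sub.
  by apply: submonoid_setD_irreducible => // y ->.
move=> y Ay; split; last by move=> yx; rewrite -yx in nAx.
by rewrite -AS; exact: sub_gen_smallest.
Qed.

(** The irreducible elements generate [S] and lie in every generating set, hence are the only
    minimal one. *)
Lemma msgE (S : set nat) : submonoid S -> msg S = irreducible S.
Proof.
move=> mS; have gI := generated_irreducible mS.
apply: xget_unique.
  split=> // B [_ nIB] BS; apply: nIB; exact: irreducible_sub_generators.
move=> A [AS minA]; have IA := irreducible_sub_generators mS AS.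
apply: contrapT => AI; apply: (minA (irreducible S)) => //; split=> // AsubI.
by apply: AI; apply/seteqP.
Qed.

(** * Sons of a Coe-semigroup *)

Lemma Frobenius_odd (S : set nat) (f : nat) :
  Coe S -> Frobenius S = f%:Z -> odd f.
Proof.
move=> [[_ fS] cS] Ff; apply: contrapT => /negP ef.
have Sf1 : S f.+1 by apply: gt_Frobenius; rewrite // Ff; lia.
apply: (Frobenius_notin fS Ff).
by apply: (cS f.+1) => //=; left.
Qed.

(** Treats at once the removal of [f] alone and of both [f - 1] and [f]. The last hypothesis keeps
    the Coe property at [f - 2], the only odd number left that could lose a neighbour. *)
Lemma son_setD (S D : set nat) (f : nat) : Coe S -> odd f ->
  Frobenius S < f%:Z -> D f -> D `<=` irreducible S `&` [set f.-1; f] ->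
  (D f.-1 -> ~ S f.-2) -> sons S (S `\` D).
Proof.
move=> [[mS fS] cS] fodd Ff Df DI Df1.
have Sf : S f by have [[]] := DI _ Df.
have Sf1 : S f.-1 by apply: (cS f) => //; left.
have nTf : ~ zset (S `\` D) f by move=> /zset_nat[].
have FT : Frobenius (S `\` D) = f.
  apply: Frobenius_eq => //; case=> g fg; last by lia.
  apply/zset_nat; split; first by apply: gt_Frobenius => //; lia.
  by move=> /DI[_ [] /= ?]; lia.
have f1E : f%:Z - 1 = f.-1%:Z by lia.
split=> //.
- split; first split.
  + by apply: submonoid_setD_irreducible => // x /DI[].
  + rewrite setCD; rewrite finite_setU; split=> //.
    by apply: sub_finite_set (finite_set2 f.-1 f) => x /DI[].
  + move=> x ox [Sx nDx].
    have xf : x <> f by move=> xf; rewrite xf in nDx.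
    move=> y yx; split; first exact: cS yx.
    move=> Dy; have [_ yf] := DI _ Dy.
    (* As [x] and [f] are odd, [y] is even, so [y = f - 1]; its odd neighbour [f] has been
       removed. *)
    have xf2 : x = f.-2 /\ y = f.-1.
      by case: yx yf => /= -> [] /= ?; lia.
    by case: xf2 => xf2 yf1; apply: Df1; [rewrite -yf1 | rewrite -xf2].
- by move=> SD; apply: nTf; rewrite SD; exact/zset_nat.
- rewrite FT f1E; apply/seteqP; split.
    move=> _ [x Sx <-].
    have [Dx|nDx] := pselect (D x); last by left; apply/zset_nat.
    by right; have [_ []/= ->] := DI _ Dx; [left|right].
  by move=> x [[y [Sy _] <-]|[]->]; apply/zset_nat.
Qed.

(** The witness is the Frobenius number of [T]; the two alternatives are whether or not [f - 1] is
    in [T]. *)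
Lemma son_cases (S T : set nat) : Coe S -> sons S T -> exists f : nat,
  [/\ odd f, irreducible S f & Frobenius S < f%:Z] /\
  (T = S `\ f \/ [/\ T = S `\` [set f.-1; f], irreducible S f.-1
                   & Frobenius S + 2 = f%:Z]).
Proof.
move=> CS [CT _ _ TS].
have [[mS fS] cS] := CS; have [[mT fT] cT] := CT.
(* A negative Frobenius number of [T] would put a negative integer into [zset S]. *)
case FT: (Frobenius T) (Frobenius_geN1 fT) TS => [f|k] FTge TS; last first.
  have : zset S (Negz k - 1) by rewrite TS; right; left.
  by case=> n _; lia.
have fodd := Frobenius_odd CT FT.
have nTf := Frobenius_notin fT FT.
have f1E : f%:Z - 1 = f.-1%:Z by lia.
have SE x : S x <-> T x \/ (x = f.-1 \/ x = f).
  split.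
    move=> /zset_nat; rewrite TS f1E.
    by move=> [/zset_nat|[/= [->]|/= [->]]]; [left|right; left|right; right].
  move=> H; apply/zset_nat; rewrite TS f1E.
  by case: H => [|[->|->]]; [left; apply/zset_nat|right; left|right; right].
have Sf : S f by apply/SE; right; right.
have Sf1 : S f.-1 by apply/SE; right; left.
have Tge n : (f < n)%N -> T n by move=> fn; apply: gt_Frobenius; rewrite // FT.
have FSf : Frobenius S < f%:Z.
  rewrite ltNge; apply/negP; case FS: (Frobenius S) => [g|//] fg.
  apply: (Frobenius_notin fS FS); apply/SE.
  have [->|/eqP gf] := eqVneq g f; first by right; right.
  by left; apply: Tge; lia.
have [Tf1|nTf1] := pselect (T f.-1).
  exists f; split; last first.
    left; apply/seteqP; split=> x.
      by move=> Tx; split; [apply/SE; left | move=> /= xf; rewrite xf in Tx].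
    by move=> [/SE[//|[-> //|->]]] [].
  split=> //; split=> // [|a b /SE Sa /SE Sb abf]; first by lia.
  have [|/eqP a0] := eqVneq a 0%N; first by left.
  have [|/eqP b0] := eqVneq b 0%N; first by right.
  (* Both summands are smaller than [f], the only element of [S] missing from [T], so their sum
     would be in [T]. *)
  case: nTf; rewrite -abf; apply: mT.2.
    by case: Sa => [//|[-> //|]]; lia.
  by case: Sb => [//|[-> //|]]; lia.
(* Being odd, [f] is now at least 3, so [f.-2] is not truncated. *)
have f1_neq0 : f.-1 <> 0%N by move=> f10; apply: nTf1; rewrite f10; exact: mT.1.
have nSf2 : ~ S f.-2.
  move=> /SE[Tf2|]; last by lia.
  by apply: nTf1; apply: (cT f.-2) => //=; [lia | right=> /=; lia].
have S_small x : S x -> (x < f.-1)%N -> T x by move=> /SE[//|]; lia.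
(* This excludes the decomposition of [f] as 1 plus [f - 1], whose second summand is not in [T]. *)
have nS1 : ~ S 1%N.
  move=> S1; have T1 : T 1%N by apply: S_small => //; lia.
  have TT n : T n by elim: n => [|n IH]; [exact: mT.1 | rewrite -addn1; exact: mT.2].
  by apply: nTf.
exists f; split; last first.
  right; split.
  - apply/seteqP; split=> x.
      move=> Tx; split; first by apply/SE; left.
      by move=> /= [] xf; rewrite xf in Tx.
    by move=> [/SE[//|? []]].
  - split=> // a b Sa Sb abf.
    have [|/eqP a0] := eqVneq a 0%N; first by left.
    have [|/eqP b0] := eqVneq b 0%N; first by right.
    by case: nTf1; rewrite -abf; apply: mT.2; apply: S_small => //; lia.
  - rewrite (@Frobenius_eq S f.-2%:Z); first by lia.
      by move/zset_nat.
    case=> g fg; last by lia.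
    apply/zset_nat/SE.
    have [fg'|] := ltnP f g; first by left; exact: Tge.
    by right; lia.
split=> //; split=> // [|a b Sa Sb abf]; first by lia.
have [|/eqP a0] := eqVneq a 0%N; first by left.
have [|/eqP b0] := eqVneq b 0%N; first by right.
have [a1|/eqP a1] := eqVneq a 1%N; first by rewrite a1 in Sa.
have [b1|/eqP b1] := eqVneq b 1%N; first by rewrite b1 in Sb.
by case: nTf; rewrite -abf; apply: mT.2; apply: S_small => //; lia.
Qed.

Lemma son_setD1 (S : set nat) (x : nat) : Coe S ->
  odd x -> irreducible S x -> Frobenius S < x%:Z -> sons S (S `\ x).
Proof.
move=> CS ox Ix Fx; apply: (@son_setD _ _ x) => //.
  by move=> y ->; split=> //; right.
by move=> /= ?; lia.
Qed.

Lemma Frobenius_pairE (S : set nat) (f : nat) : (0 < f)%N ->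
  Frobenius S + 2 = f%:Z ->
  [set n : nat | [set Frobenius S + 1; Frobenius S + 2] n%:Z] = [set f.-1; f].
Proof.
move=> f0 Ff; apply/seteqP.
by split=> n /= [] ?; by [left; lia | right; lia].
Qed.

Theorem theorem16 (S : set nat) (hS : Coe S) :
  (~ ([set Frobenius S + 1; Frobenius S + 2] `<=` zset (msg S)) ->
     sons S =
       [set S `\ x | x in [set x : nat |
          [/\ odd x, msg S x & Frobenius S < x%:Z]]]) /\
  ([set Frobenius S + 1; Frobenius S + 2] `<=` zset (msg S) ->
     sons S =
       [set S `\ x | x in [set x : nat |
          [/\ odd x, msg S x & Frobenius S < x%:Z]]]
       `|` [set S `\` [set n : nat |
              [set Frobenius S + 1; Frobenius S + 2] n%:Z]]).
Proof.
have [[mS fS] _] := hS; rewrite (msgE mS).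
split=> FI; apply/seteqP; split=> T.
- move=> /(son_cases hS)[f [If [->|[_ If1 Ff]]]]; first by exists f.
  (* A son missing two elements would make both F(S) + 1 and F(S) + 2 irreducible. *)
  case: FI => x [] /= ->; last by rewrite Ff; apply/zset_nat; case: If.
  have -> : Frobenius S + 1 = f.-1%:Z by case: If => fodd _ _; lia.
  exact/zset_nat.
- by move=> [x [ox Ix Fx] <-]; exact: son_setD1.
- move=> /(son_cases hS)[f [If [->|[-> If1 Ff]]]]; first by left; exists f.
  right; rewrite /= (@Frobenius_pairE _ f) //; case: If => fodd _ _; lia.
- move=> [[x [ox Ix Fx] <-]|/= ->]; first exact: son_setD1.
  (* Irreducible elements are nonzero, so F(S) + 1 is a positive [n]. This rules out F(S) = -1, so
     F(S) is odd, and [son_setD] applies with [f = n + 1], where [f - 2] is F(S). *)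
  have [n In nF] : zset (irreducible S) (Frobenius S + 1) by apply: FI; left.
  have [_ n0 _] := In.
  have Fn : Frobenius S = n.-1%:Z by lia.
  have on := Frobenius_odd hS Fn.
  have In1 : irreducible S n.+1.
    by apply/zset_nat/FI; right => /=; lia.
  rewrite (@Frobenius_pairE _ n.+1) //; last by lia.
  apply: (@son_setD _ _ n.+1) => //=.
  + by lia.
  + by lia.
  + by right.
  + by move=> x [] /= ->; split=> //; [left|right].
  + by move=> _; exact: Frobenius_notin.
Qed.
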